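(* For any boolean function $f$ defined on $\{0,1\}^n$, we have $$\forall p\in[0,1]\qquad P(f=1)\,\leq\,2\exp\Big(-\frac{1}{2n}\Big(p(1-p)\,E\big(S_n\,\big|\,f=1\big)\Big)^2\Big)\,.$$
   Context: Let $n\geq 1$ and $\Omega=\{0,1\}^n$, with elements $\omega=(\omega(1),\dots,\omega(n))$. The probability $P$ on $\Omega$ is the Bernoulli product measure of parameter $p$: $P(\omega)=\prod_{1\leq i\leq n}p^{\omega(i)}(1-p)^{1-\omega(i)}$, and $E$ is the expectation with respect to $P$. A boolean function is any function $f:\Omega\to\{0,1\}$ (no monotonicity is assumed here). For $i\in\{1,\dots,n\}$, the random variable $X_i$ is defined on $\Omega$ by $X_i(\omega)=\dfrac{\omega(i)}{p}-\dfrac{1-\omega(i)}{1-p}$, and $S_n=X_1+\cdots+X_n$. For a random variable $Y$ on $\Omega$, $E(Y\,|\,f=1)$ denotes the elementary conditional expectation $\frac{1}{P(f=1)}\sum_{\omega:\,f(\omega)=1}Y(\omega)P(\omega)$. *)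

(* Defs.v *)
From mathcomp Require Import all_boot all_order all_algebra.
From mathcomp Require Import all_classical all_reals all_analysis.

Set Implicit Arguments.
Unset Strict Implicit.
Unset Printing Implicit Defensive.

Import Order.TTheory GRing.Theory Num.Theory.
Local Open Scope ring_scope.

(* Coordinates are indexed by 0, ..., n-1 instead of 1, ..., n, and the
   values 0 and 1 are [false] and [true] (which coerce to 0 and 1 in nat). *)
Definition Omega (n : nat) := {ffun 'I_n -> bool}.

(* As [x ^+ 0 = 1], this is a probability on [Omega n] also when p is 0 or 1. *)
Definition bernoulli_weight (R : realType) (n : nat) (p : R)
    (omega : Omega n) : R :=
  \prod_(i < n) (p ^+ omega i * (1 - p) ^+ (1 - omega i)).

Definition Pr (R : realType) (n : nat) (p : R) (A : {set Omega n}) : R :=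
  \sum_(omega in A) bernoulli_weight p omega.

(* Elementary conditional expectation E(Y | A). It is 0 when [Pr p A = 0],
   where it is mathematically undefined. *)
Definition condE (R : realType) (n : nat) (p : R) (Y : Omega n -> R)
    (A : {set Omega n}) : R :=
  (Pr p A)^-1 * \sum_(omega in A) Y omega * bernoulli_weight p omega.

(* For p = 0 or p = 1 one of the quotients is [_ / 0 = 0]. The quantity
   p (1 - p) E(S_n | A) is then 0. This agrees with reading p (1 - p) X_i as
   omega(i) - p, which vanishes P-almost surely at both endpoints. *)
Definition X (R : realType) (n : nat) (p : R) (i : 'I_n) (omega : Omega n) : R :=
  (omega i)%:R / p - (1 - (omega i)%:R) / (1 - p).

Definition S_n (R : realType) (n : nat) (p : R) (omega : Omega n) : R :=
  \sum_(i < n) X p i omega.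

(* Main.v *)
Require Import Defs.
From mathcomp Require Import all_boot all_order all_algebra.
From mathcomp Require Import all_classical all_reals all_analysis.
From mathcomp Require Import ring lra.

(** Up to the factor [p (1 - p)], [S_n] is the sum [T] of the centred variables
    [omega i - p]. Let [m = E(T | A)]. Jensen's inequality gives
    [P(A) exp(l m) <= E(exp(l T); A) <= E(exp(l T))], and the right-hand side is
    at most [exp(n l^2 / 2)] by a weak form of Hoeffding's lemma; take [l = m / n].
    This even yields the bound without the factor 2. *)

Set Implicit Arguments.
Unset Strict Implicit.
Unset Printing Implicit Defensive.

Import Order.TTheory GRing.Theory Num.Theory.
Local Open Scope ring_scope.

Lemma expR_half_sqr (R : realType) (x : R) : expR (x / 2) ^+ 2 = expR x.
Proof. by rewrite -expRM_natl; congr expR; field. Qed.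

(** Square and invert the tangent bound [1 - x / 2 <= expR (- x / 2)]; [x < 2] keeps its left side
    positive. *)
Lemma expR_le_inv_sqr (R : realType) (x : R) :
  x < 2 -> expR x <= ((1 - x / 2) ^+ 2)^-1.
Proof.
move=> x2; rewrite -(opprK x) expRN lef_pV2 ?posrE ?expR_gt0 ?exprn_gt0 //; last lra.
rewrite -[leRHS]expR_half_sqr opprK ler_sqr ?nnegrE ?expR_ge0 //; last lra.
by have := expR_ge1Dx (- x / 2); lra.
Qed.

(** The sharp exponent is [x ^+ 2 / 2]; this cruder one suffices because it is used at [l / 2]. For
    [|x| > 1] it follows from [|x| <= x ^+ 2]; otherwise both sides are compared with rational
    functions of [x]. *)
Lemma cosh_le_expR_sqr (R : realType) (x : R) :
  (expR x + expR (- x)) / 2 <= expR (x ^+ 2).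
Proof.
have [x1|x1] := lerP `|x| 1; last first.
  have le_sqr : `|x| <= x ^+ 2 by rewrite -real_normK ?num_real //; nra.
  have : expR x <= expR (x ^+ 2).
    by rewrite ler_expR (le_trans (ler_norm _)).
  have : expR (- x) <= expR (x ^+ 2).
    by rewrite ler_expR (le_trans (ler_norm _)) ?normrN.
  lra.
have /andP[xl xu] : -1 <= x <= 1 by rewrite -ler_norml.
have ex : expR x <= ((1 - x / 2) ^+ 2)^-1 by apply: expR_le_inv_sqr; lra.
have eNx : expR (- x) <= ((1 + x / 2) ^+ 2)^-1.
  by have := @expR_le_inv_sqr _ (- x); rewrite mulNr opprK; apply; lra.
have e2 : (1 + x ^+ 2 / 2) ^+ 2 <= expR (x ^+ 2).
  by rewrite -[leRHS]expR_half_sqr ler_sqr ?nnegrE ?expR_ge0 ?expR_ge1Dx //; nra.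
apply: le_trans e2.
apply: (@le_trans _ _ ((1 + x ^+ 2 / 4) / (1 - x ^+ 2 / 4) ^+ 2)).
  have -> : (1 + x ^+ 2 / 4) / (1 - x ^+ 2 / 4) ^+ 2 =
      (((1 - x / 2) ^+ 2)^-1 + ((1 + x / 2) ^+ 2)^-1) / 2 :> R.
    by field; apply/and3P; split; apply/eqP; nra.
  lra.
have u1 : x ^+ 2 <= 1 by nra.
have u0 : 0 <= x ^+ 2 by exact: sqr_ge0.
rewrite ler_pdivrMr; last by rewrite exprn_gt0 //; lra.
have -> : x ^+ 2 = 4 * (x ^+ 2 / 4) by field.
set u := x ^+ 2 / 4.
have v0 : 0 <= u by rewrite /u; lra.
have v1 : u <= 1 / 4 by rewrite /u; lra.
(* With the denominator cleared, a polynomial inequality in [u] on [[0, 1/4]] remains; the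
   factorization shows its sign. *)
rewrite -subr_ge0.
have -> : (1 + 4 * u / 2) ^+ 2 * (1 - 4 * u / 4) ^+ 2 - (1 + 4 * u / 4) =
  u * ((1 / 4 - u) * (4 + 4 * u) + 4 * u ^+ 3) by field.
have u3 : 0 <= u ^+ 3 by exact: exprn_ge0.
by apply: mulr_ge0 => //; apply: addr_ge0; apply: mulr_ge0 => //; lra.
Qed.

(* Multiplying by the moment generating function at [- l], which is at least 1,
   symmetrizes the variable. *)
Lemma bernoulli_mgf_le (R : realType) (p l : R) : 0 <= p <= 1 ->
  p * expR (l * (1 - p)) + (1 - p) * expR (- (l * p)) <= expR (l ^+ 2 / 2).
Proof.
move=> /andP[p0 p1].
set a := expR (l * (1 - p)); set b := expR (- (l * p)).
set a' := expR (- (l * (1 - p))); set b' := expR (l * p).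
have aa' : a * a' = 1 by rewrite expRxMexpNx_1.
have bb' : b * b' = 1 by rewrite mulrC expRxMexpNx_1.
have ab' : a * b' = expR l by rewrite -expRD; congr expR; ring.
have ba' : b * a' = expR (- l) by rewrite -expRD; congr expR; ring.
have mgf_ge0 : 0 <= p * a + (1 - p) * b.
  by rewrite addr_ge0 // mulr_ge0 ?expR_ge0 //; lra.
(* The variable is centred, so the tangent bounds average to exactly 1. *)
have mgfN_ge1 : 1 <= p * a' + (1 - p) * b'.
  have : 1 - l * (1 - p) <= a' by exact: expR_ge1Dx.
  have : 1 + l * p <= b' by exact: expR_ge1Dx.
  nra.
apply: (le_trans (ler_peMr mgf_ge0 mgfN_ge1)).
set c := (expR (l / 2) + expR (- (l / 2))) / 2.
have c2 : c ^+ 2 = (2 + expR l + expR (- l)) / 4.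
  have := expRxMexpNx_1 (l / 2).
  by rewrite /c -(expR_half_sqr l) -(expR_half_sqr (- l)) mulNr => h; nra.
have c0 : 0 <= c by rewrite divr_ge0 // addr_ge0 ?expR_ge0.
(* The product is [1 + p * (1 - p) * (expR l + expR (- l) - 2)], which is largest at [p = 1 / 2],
   where it equals [c ^+ 2]. *)
apply: (@le_trans _ _ (c ^+ 2)).
  have -> : (p * a + (1 - p) * b) * (p * a' + (1 - p) * b') =
      p ^+ 2 * (a * a') + (1 - p) ^+ 2 * (b * b') +
      p * (1 - p) * (a * b' + b * a') by ring.
  rewrite aa' bb' ab' ba' c2.
  have : 2 <= expR l + expR (- l).
    by have := expR_ge1Dx l; have := expR_ge1Dx (- l); lra.
  have : p * (1 - p) <= 1 / 4 by have := sqr_ge0 (p - 1 / 2); nra.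
  nra.
rewrite -[leRHS]expR_half_sqr ler_sqr ?nnegrE ?expR_ge0 //.
have -> : l ^+ 2 / 2 / 2 = (l / 2) ^+ 2 by field.
exact: cosh_le_expR_sqr.
Qed.

Lemma bernoulli_weight_ge0 (R : realType) (n : nat) (p : R) (omega : Omega n) :
  0 <= p <= 1 -> 0 <= bernoulli_weight p omega.
Proof.
move=> /andP[p0 p1]; apply: prodr_ge0 => i _.
by rewrite mulr_ge0 // exprn_ge0 // subr_ge0.
Qed.

Definition centered_sum (R : realType) (n : nat) (p : R) (omega : Omega n) : R :=
  \sum_(i < n) ((omega i)%:R - p).

(** By independence, the sum over [Omega n] factors into [n] identical one-coordinate sums. *)
Lemma centered_sum_mgf_le (R : realType) (n : nat) (p l : R) : 0 <= p <= 1 ->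
  \sum_(omega : Omega n) bernoulli_weight p omega * expR (l * centered_sum p omega)
    <= expR (n%:R * (l ^+ 2 / 2)).
Proof.
move=> p01.
pose F (i : 'I_n) (b : bool) := p ^+ b * (1 - p) ^+ (1 - b) * expR (l * (b%:R - p)).
have -> : \sum_(omega : Omega n)
      bernoulli_weight p omega * expR (l * centered_sum p omega)
    = \sum_(omega : Omega n) \prod_(i < n) F i (omega i).
  apply: eq_bigr => omega _.
  by rewrite /F big_split /= -expR_sum mulr_sumr.
rewrite -(bigA_distr_bigA F) expRM_natl -[in leRHS](card_ord n) -prodr_const.
apply: ler_prod => i _; apply/andP; split.
  have /andP[p0 p1] := p01.
  apply: sumr_ge0 => b _.
  by rewrite /F !mulr_ge0 ?exprn_ge0 ?expR_ge0 ?subr_ge0.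
apply: le_trans (bernoulli_mgf_le l p01).
by rewrite big_bool /F /= subnn subn0 !expr0 !expr1 mulr1 mul1r sub0r mulrN.
Qed.

Lemma Pr_mul_expR_condE_le (R : realType) (n : nat) (p l : R)
    (A : {set Omega n}) : 0 <= p <= 1 ->
  Pr p A * expR (l * condE p (centered_sum p) A) <= expR (n%:R * (l ^+ 2 / 2)).
Proof.
move=> p01; have w0 omega := bernoulli_weight_ge0 omega p01.
have [PA0|PA0] := eqVneq (Pr p A) 0; first by rewrite PA0 mul0r expR_ge0.
apply: le_trans (centered_sum_mgf_le n l p01).
apply: (@le_trans _ _ (\sum_(omega in A)
    bernoulli_weight p omega * expR (l * centered_sum p omega))); last first.
  rewrite [leRHS](bigID (mem A)) /= lerDl.
  by apply: sumr_ge0 => omega _; rewrite mulr_ge0 ?expR_ge0.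
set m := condE _ _ _; set T := centered_sum p.
have mE : Pr p A * m = \sum_(omega in A) T omega * bernoulli_weight p omega.
  by rewrite /m /condE mulrA divff // mul1r.
(* Jensen's inequality, from the tangent to the exponential at [l * m] *)
have -> : Pr p A * expR (l * m) = \sum_(omega in A)
    bernoulli_weight p omega * (expR (l * m) * (1 + (l * T omega - l * m))).
  transitivity (expR (l * m) * ((1 - l * m) * Pr p A +
      l * \sum_(omega in A) T omega * bernoulli_weight p omega)).
    by rewrite -mE; ring.
  rewrite /Pr !mulr_sumr -big_split /= mulr_sumr.
  by apply: eq_bigr => omega _; ring.
apply: ler_sum => omega _; apply: ler_wpM2l => //.
have -> : l * T omega = l * m + (l * T omega - l * m) by ring.
rewrite expRD [X in 1 + (X - _)]addrC subrK ler_wpM2l ?expR_ge0 //.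
exact: expR_ge1Dx.
Qed.

Lemma condE_S_n (R : realType) (n : nat) (p : R) (A : {set Omega n}) :
  p != 0 -> 1 - p != 0 ->
  p * (1 - p) * condE p (S_n p) A = condE p (centered_sum p) A.
Proof.
move=> p0 q0; rewrite /condE mulrCA; congr (_ * _).
rewrite mulr_sumr; apply: eq_bigr => omega _; rewrite mulrA; congr (_ * _).
rewrite /S_n /centered_sum mulr_sumr; apply: eq_bigr => i _.
by rewrite /X; field; rewrite p0 q0.
Qed.

Theorem proposition9p1 (R : realType) (n : nat) (hn : (1 <= n)%N)
    (f : Omega n -> bool) (p : R) (hp : 0 <= p <= 1) :
  Pr p [set omega | f omega]%SET <=
    2 * expR (- (1 / (2 * n%:R) *
                 (p * (1 - p) * condE p (S_n p) [set omega | f omega]%SET) ^+ 2)).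
Proof.
set A := [set omega | f omega]%SET.
have [pq0|] := eqVneq (p * (1 - p)) 0.
  (* At [p = 0] or [p = 1] the right-hand side is 2, and [l = 0] gives [Pr p A <= 1]. *)
  have := Pr_mul_expR_condE_le 0 A hp.
  rewrite pq0 !mul0r expr0n /= !mul0r !mulr0 oppr0 expR0; lra.
rewrite mulf_eq0 negb_or => /andP[p0 q0]; rewrite condE_S_n //.
set m := condE _ _ _; set e := expR _.
have n0 : n%:R != 0 :> R by rewrite pnatr_eq0 -lt0n.
suff : Pr p A <= e by have : 0 <= e := expR_ge0 _; lra.
(* This [l] minimizes [n * l ^+ 2 / 2 - l * m], with minimum [- m ^+ 2 / (2 * n)]. *)
have := Pr_mul_expR_condE_le (m / n%:R) A hp.
rewrite -/m -ler_pdivlMr ?expR_gt0 // -expRN -expRD.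
by congr (_ <= expR _); field.
Qed.
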